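(* Let $n \ge 0$. A ring $R$ is $n$-subperfect if and only if, for each regular sequence $x_1,\ldots,x_i$ in $R$, the ring $R/(x_1,\ldots,x_i)R$ is $(n-i)$-subperfect.
   Context: All rings are commutative with identity. A ring is perfect if every flat module over it is projective (equivalently, it satisfies the descending chain condition on principal ideals). $Q(A)$ denotes the total quotient ring of a ring $A$, and $A$ is subperfect if $Q(A)$ is perfect. A sequence $x_1,\ldots,x_i$ in $A$ is a regular sequence if $(x_1,\ldots,x_i)A\neq A$ and each $x_j$ is a non-zero-divisor on $A/(x_1,\ldots,x_{j-1})A$; the empty sequence is considered a regular sequence. A ring $A$ is regularly subperfect if for each regular sequence $x_1,\ldots,x_i$ in $A$ (including the empty one) the ring $A/(x_1,\ldots,x_i)A$ is subperfect. For an integer $n\ge 0$, $A$ is $n$-subperfect if $A$ is regularly subperfect and every maximal regular sequence in $A$ has length $n$. *)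

(* Defs.v *)
From HB Require Import structures.
From mathcomp Require Import all_boot all_algebra.
From mathcomp Require Import boolp.

Set Implicit Arguments.
Unset Strict Implicit.
Unset Printing Implicit Defensive.

Import GRing.Theory.
Local Open Scope ring_scope.
Local Open Scope quotient_scope.

(* Rings are comPzRingType, so that the zero ring is allowed. *)

Section GeneratedIdeal.
Variables (A : comPzRingType) (xs : seq A).

Definition gen_ideal : {pred A} :=
  fun a => `[< exists c : nat -> A, a = \sum_(i < size xs) c i * xs`_i >].

Lemma gen_idealP a :
  reflect (exists c : nat -> A, a = \sum_(i < size xs) c i * xs`_i)
          (a \in gen_ideal).
Proof. exact: asboolP. Qed.

Lemma gen_ideal_zmod_closed : zmod_closed gen_ideal.
Proof.
split=> [|a b /gen_idealP[c ->] /gen_idealP[d ->]]; apply/gen_idealP.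
  by exists (fun=> 0); rewrite big1// => i _; rewrite mul0r.
exists (fun i => c i - d i); rewrite -sumrB.
by apply: eq_bigr => i _; rewrite mulrBl.
Qed.

HB.instance Definition _ :=
  GRing.isZmodClosed.Build A gen_ideal gen_ideal_zmod_closed.

Lemma gen_idealMl a b : b \in gen_ideal -> a * b \in gen_ideal.
Proof.
move=> /gen_idealP[c ->]; apply/gen_idealP; exists (fun i => a * c i).
by rewrite mulr_sumr; apply: eq_bigr => i _; rewrite mulrA.
Qed.

(* Quotient.quot is the library's quotient group; the library only makes it a
   ring for proper ideals of nontrivial rings. *)
Definition quo_ring : Type := @Quotient.quot A gen_ideal.

HB.instance Definition _ := GRing.Zmodule.on quo_ring.
HB.instance Definition _ :=
  EqQuotient.copy quo_ring (@Quotient.quot A gen_ideal).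
HB.instance Definition _ :=
  ZmodQuotient.copy quo_ring (@Quotient.quot A gen_ideal).

Definition quo_mul := lift_op2 quo_ring *%R.

Let pi_eq (a b : A) :
  (\pi_quo_ring a = \pi_quo_ring b) <-> (a - b \in gen_ideal).
Proof. by rewrite Quotient.idealrBE; split=> [->|/eqP]. Qed.

Let quo_mulE (a b : A) :
  quo_mul (\pi_quo_ring a) (\pi_quo_ring b) = \pi_quo_ring (a * b).
Proof.
unlock quo_mul; apply/pi_eq.
set a' := repr _; set b' := repr _.
have Ha : a' - a \in gen_ideal by apply/pi_eq; rewrite reprK.
have Hb : b' - b \in gen_ideal by apply/pi_eq; rewrite reprK.
have -> : a' * b' - a * b = b' * (a' - a) + a * (b' - b).
  by rewrite !mulrBr [b' * a']mulrC [b' * a]mulrC addrA addrNK.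
by apply: rpredD; apply: gen_idealMl.
Qed.

Let quo_mulA : associative quo_mul.
Proof.
elim/quotW=> a; elim/quotW=> b; elim/quotW=> c.
by rewrite !quo_mulE mulrA.
Qed.

Let quo_mulC : commutative quo_mul.
Proof. by elim/quotW=> a; elim/quotW=> b; rewrite !quo_mulE mulrC. Qed.

Let quo_mul1 : left_id (\pi_quo_ring 1) quo_mul.
Proof. by elim/quotW=> a; rewrite quo_mulE mul1r. Qed.

Let quo_mulD : left_distributive quo_mul +%R.
Proof.
elim/quotW=> a; elim/quotW=> b; elim/quotW=> c.
by rewrite -!pi_addr !quo_mulE -pi_addr mulrDl.
Qed.

HB.instance Definition _ := GRing.Zmodule_isComPzRing.Build quo_ring
  quo_mulA quo_mulC quo_mul1 quo_mulD.

Definition to_quo (a : A) : quo_ring := \pi_quo_ring a.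

Lemma to_quo_is_zmod_morphism : zmod_morphism to_quo.
Proof. by move=> a b; rewrite /to_quo pi_addr pi_oppr. Qed.

Lemma to_quo_is_monoid_morphism : monoid_morphism to_quo.
Proof. by split=> // a b; rewrite [RHS]quo_mulE. Qed.

HB.instance Definition _ := GRing.isZmodMorphism.Build A quo_ring to_quo
  to_quo_is_zmod_morphism.
HB.instance Definition _ := GRing.isMonoidMorphism.Build A quo_ring to_quo
  to_quo_is_monoid_morphism.

Lemma to_quo_eq (a b : A) : to_quo a = to_quo b <-> a - b \in gen_ideal.
Proof. exact: pi_eq. Qed.

Lemma to_quo_surj (u : quo_ring) : exists a, to_quo a = u.
Proof. by exists (repr u); rewrite /to_quo reprK. Qed.

End GeneratedIdeal.

Definition nonzerodivisor (A : pzRingType) (a : A) : Prop :=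
  forall b : A, a * b = 0 -> b = 0.

Section TotalQuotientRing.
Variable A : comPzRingType.

Lemma nonzerodivisor1 : nonzerodivisor (1 : A).
Proof. by move=> b; rewrite mul1r. Qed.

Lemma nonzerodivisorM (s t : A) :
  nonzerodivisor s -> nonzerodivisor t -> nonzerodivisor (s * t).
Proof. by move=> Hs Ht b; rewrite -mulrA => /Hs /Ht. Qed.

Lemma nonzerodivisorI (s a b : A) :
  nonzerodivisor s -> s * a = s * b -> a = b.
Proof. by move=> Hs /eqP; rewrite -subr_eq0 -mulrBr => /eqP/Hs/subr0_eq. Qed.

(* Pairs (a, s) representing a / s. *)
Definition tfrac := {p : A * A | `[< nonzerodivisor p.2 >]}.
HB.instance Definition _ := Choice.on tfrac.

Definition num (p : tfrac) : A := (val p).1.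
Definition den (p : tfrac) : A := (val p).2.

Lemma den_nonzerodivisor (p : tfrac) : nonzerodivisor (den p).
Proof. exact: (asboolW (valP p)). Qed.

Definition mk_tfrac (a s : A) (Hs : nonzerodivisor s) : tfrac :=
  exist _ (a, s) (asboolT Hs).

Lemma num_mk a s (Hs : nonzerodivisor s) : num (mk_tfrac a Hs) = a.
Proof. by []. Qed.

Lemma den_mk a s (Hs : nonzerodivisor s) : den (mk_tfrac a Hs) = s.
Proof. by []. Qed.

Definition tfrac_equiv (p q : tfrac) : bool := num p * den q == num q * den p.

Let tfrac_refl : reflexive tfrac_equiv.
Proof. by move=> p; exact: eqxx. Qed.

Let tfrac_sym : symmetric tfrac_equiv.
Proof. by move=> p q; exact: eq_sym. Qed.

Let tfrac_trans : transitive tfrac_equiv.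
Proof.
move=> q p r /eqP pq /eqP qr; apply/eqP.
apply: (nonzerodivisorI (@den_nonzerodivisor q)).
by rewrite !mulrA [den q * num p]mulrC [den q * num r]mulrC pq mulrAC qr.
Qed.

Canonical tfrac_equiv_equiv :=
  EquivRel tfrac_equiv tfrac_refl tfrac_sym tfrac_trans.

Definition total_quotient : Type := {eq_quot tfrac_equiv}.
HB.instance Definition _ : EqQuotient tfrac tfrac_equiv total_quotient :=
  EqQuotient.on total_quotient.
HB.instance Definition _ := Choice.on total_quotient.

Local Notation "\Pi p" := (\pi_total_quotient p) (at level 10).

Let Pi_eq (p q : tfrac) :
  \Pi p = \Pi q <-> num p * den q = num q * den p.
Proof. by split=> [/eqmodP/eqP|H]//; apply/eqmodP/eqP. Qed.

Definition tf0 : tfrac := mk_tfrac 0 nonzerodivisor1.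
Definition tf1 : tfrac := mk_tfrac 1 nonzerodivisor1.
Definition tfD (p q : tfrac) : tfrac := mk_tfrac (num p * den q + num q * den p)
  (nonzerodivisorM (@den_nonzerodivisor p) (@den_nonzerodivisor q)).
Definition tfM (p q : tfrac) : tfrac := mk_tfrac (num p * num q)
  (nonzerodivisorM (@den_nonzerodivisor p) (@den_nonzerodivisor q)).
Definition tfN (p : tfrac) : tfrac := mk_tfrac (- num p) (@den_nonzerodivisor p).

Definition tqD := lift_op2 total_quotient tfD.
Definition tqM := lift_op2 total_quotient tfM.
Definition tqN := lift_op1 total_quotient tfN.

Let repr_eq (p : tfrac) :
  num (repr (\Pi p)) * den p = num p * den (repr (\Pi p)).
Proof. by apply/Pi_eq; rewrite reprK. Qed.

Let tqDE p q : tqD (\Pi p) (\Pi q) = \Pi (tfD p q).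
Proof.
unlock tqD; apply/Pi_eq; have := repr_eq q; have := repr_eq p.
set p' := repr _; set q' := repr _; rewrite ?num_mk ?den_mk.
move: (num p) (den p) (num q) (den q) (num p') (den p') (num q') (den q').
move=> a s b t a' s' b' t'.
move=> Hp Hq; rewrite !mulrDl; congr (_ + _).
  by rewrite mulrACA Hp [t' * t]mulrC mulrACA.
by rewrite [s * t]mulrC mulrACA Hq [s' * s]mulrC mulrACA [t' * s']mulrC.
Qed.

Let tqME p q : tqM (\Pi p) (\Pi q) = \Pi (tfM p q).
Proof.
unlock tqM; apply/Pi_eq; have := repr_eq q; have := repr_eq p.
set p' := repr _; set q' := repr _; rewrite ?num_mk ?den_mk.
by move=> Hp Hq; rewrite mulrACA Hp Hq mulrACA.
Qed.

Let tqNE p : tqN (\Pi p) = \Pi (tfN p).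
Proof.
unlock tqN; apply/Pi_eq; have := repr_eq p.
set p' := repr _; rewrite ?num_mk ?den_mk.
by move=> Hp; rewrite !mulNr Hp.
Qed.

Let tqE := (tqDE, tqME, tqNE).

Let tqDA : associative tqD.
Proof.
elim/quotW=> p; elim/quotW=> q; elim/quotW=> r; rewrite !tqE.
congr (\Pi _); apply: val_inj; congr pair; rewrite /num /den /= ?mulrA//.
by rewrite !mulrDl -!addrA; congr (_ + (_ + _));
  rewrite -?mulrA// [(val p).2 * _]mulrC // mulrA.
Qed.

Let tqDC : commutative tqD.
Proof.
elim/quotW=> p; elim/quotW=> q; rewrite !tqE.
congr (\Pi _); apply: val_inj; congr pair; first by rewrite /= addrC.
by rewrite /= mulrC.
Qed.

Let tqD0 : left_id (\Pi tf0) tqD.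
Proof.
elim/quotW=> p; rewrite tqE; apply/Pi_eq.
by rewrite /num /den /= mul0r add0r mulr1 mul1r.
Qed.

Let tqDN : left_inverse (\Pi tf0) tqN tqD.
Proof.
elim/quotW=> p; rewrite !tqE; apply/Pi_eq.
by rewrite /num /den /= mulNr addNr !mul0r.
Qed.

Let tqMA : associative tqM.
Proof.
elim/quotW=> p; elim/quotW=> q; elim/quotW=> r; rewrite !tqE.
by congr (\Pi _); apply: val_inj; congr pair; rewrite /num /den /= mulrA.
Qed.

Let tqMC : commutative tqM.
Proof.
elim/quotW=> p; elim/quotW=> q; rewrite !tqE.
by congr (\Pi _); apply: val_inj; congr pair; rewrite /= mulrC.
Qed.

Let tqM1 : left_id (\Pi tf1) tqM.
Proof.
elim/quotW=> p; rewrite tqE; apply/Pi_eq.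
by rewrite /num /den /= !mul1r.
Qed.

Let tqMD : left_distributive tqM tqD.
Proof.
elim/quotW=> p; elim/quotW=> q; elim/quotW=> r; rewrite !tqE.
apply/Pi_eq; rewrite ?num_mk ?den_mk.
move: (num p) (den p) (num q) (den q) (num r) (den r) => a s b t c u.
have -> : a * c * (t * u) + b * c * (s * u) = (a * t + b * s) * c * u.
  by rewrite !mulrDl; congr (_ + _); rewrite mulrACA mulrA.
by rewrite -[RHS]mulrA; congr (_ * _); rewrite mulrACA mulrA mulrC.
Qed.

HB.instance Definition _ :=
  GRing.isZmodule.Build total_quotient tqDA tqDC tqD0 tqDN.
HB.instance Definition _ :=
  GRing.Zmodule_isComPzRing.Build total_quotient tqMA tqMC tqM1 tqMD.

End TotalQuotientRing.

Definition is_bilinear (R : comPzRingType) (M N P : lmodType R)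
    (c : M -> N -> P) : Prop :=
  (forall m, linear (c m)) /\ (forall n, linear (c^~ n)).

Definition is_tensor_product (R : comPzRingType) (M N T : lmodType R)
    (t : M -> N -> T) : Prop :=
  is_bilinear t /\
  forall (P : lmodType R) (c : M -> N -> P), is_bilinear c ->
    exists2 g : {linear T -> P}, forall m n, g (t m n) = c m n
      & forall g' : {linear T -> P},
          (forall m n, g' (t m n) = c m n) -> g' =1 g.

(* M is flat if M (x) f is injective for every injective f; the map g below is
   M (x) f. Tensor products exist: see tensor_product_exists. *)
Definition flat (R : comPzRingType) (M : lmodType R) : Prop :=
  forall (N N' : lmodType R) (f : {linear N -> N'}), injective f ->
  forall (T T' : lmodType R) (t : M -> N -> T) (t' : M -> N' -> T'),
    is_tensor_product t -> is_tensor_product t' ->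
  forall g : {linear T -> T'}, (forall m n, g (t m n) = t' m (f n)) ->
    injective g.

Definition projective (R : comPzRingType) (M : lmodType R) : Prop :=
  forall (N P : lmodType R) (g : {linear N -> P}) (f : {linear M -> P}),
    (forall p, exists n, g n = p) ->
    exists h : {linear M -> N}, forall m, g (h m) = f m.

Definition perfect (R : comPzRingType) : Prop :=
  forall M : lmodType R, flat M -> projective M.

Section TensorProduct.
Variables (R : comPzRingType) (M N : lmodType R).

(* A list of pairs stands for the sum of the corresponding pure tensors. *)
Definition tsum (P : lmodType R) (c : M -> N -> P) (s : seq (M * N)) : P :=
  \sum_(p <- s) c p.1 p.2.

Definition tensor_equiv (s s' : seq (M * N)) : bool :=
  `[< forall (P : lmodType R) (c : M -> N -> P),
        is_bilinear c -> tsum c s = tsum c s' >].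

Let tensor_refl : reflexive tensor_equiv.
Proof. by move=> s; apply/asboolP. Qed.

Let tensor_sym : symmetric tensor_equiv.
Proof.
by move=> s s'; apply/asboolP/asboolP => H P c Hc; apply/esym/H.
Qed.

Let tensor_trans : transitive tensor_equiv.
Proof.
move=> s s1 s2 /asboolP H1 /asboolP H2; apply/asboolP => P c Hc.
by rewrite H1// H2.
Qed.

Canonical tensor_equiv_equiv :=
  EquivRel tensor_equiv tensor_refl tensor_sym tensor_trans.

Definition tensor : Type := {eq_quot tensor_equiv}.
HB.instance Definition _ : EqQuotient (seq (M * N)) tensor_equiv tensor :=
  EqQuotient.on tensor.
HB.instance Definition _ := Choice.on tensor.

Let Pi_eq (s s' : seq (M * N)) :
  \pi_tensor s = \pi_tensor s' <->
  forall (P : lmodType R) (c : M -> N -> P),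
    is_bilinear c -> tsum c s = tsum c s'.
Proof. by split=> [/eqmodP/asboolP|H]//; apply/eqmodP/asboolP. Qed.

Let tsum_repr (P : lmodType R) (c : M -> N -> P) s :
  is_bilinear c -> tsum c (repr (\pi_tensor s)) = tsum c s.
Proof. by move: P c; apply/Pi_eq; rewrite reprK. Qed.

Let tsum_cat (P : lmodType R) (c : M -> N -> P) s s' :
  tsum c (s ++ s') = tsum c s + tsum c s'.
Proof. by rewrite /tsum big_cat. Qed.

Definition tscale (a : R) (s : seq (M * N)) := [seq (a *: p.1, p.2) | p <- s].

Let bilinear0 (P : lmodType R) (c : M -> N -> P) n : is_bilinear c -> c 0 n = 0.
Proof.
case=> _ /(_ n) /(_ 1 0 0); rewrite !scale1r addr0 => /eqP.
by rewrite eq_sym -subr_eq0 addrK => /eqP.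
Qed.

Let tsum_scale (P : lmodType R) (c : M -> N -> P) a s :
  is_bilinear c -> tsum c (tscale a s) = a *: tsum c s.
Proof.
move=> Hc; rewrite /tsum big_map scaler_sumr; apply: eq_bigr => p _ /=.
have [_ /(_ p.2 a p.1 0)] := Hc.
by rewrite !addr0 (bilinear0 _ Hc) addr0.
Qed.

Definition tensor0 : tensor := lift_cst tensor [::].
Definition tensorD := lift_op2 tensor (@cat (M * N)).
Definition tensorZ (a : R) := lift_op1 tensor (tscale a).
Definition tensorN := lift_op1 tensor (tscale (-1)).

Let tensor0E : tensor0 = \pi_tensor [::].
Proof. by unlock tensor0. Qed.

Let tensorDE s s' :
  tensorD (\pi_tensor s) (\pi_tensor s') = \pi_tensor (s ++ s').
Proof.
unlock tensorD; apply/Pi_eq => P c Hc.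
by rewrite !tsum_cat !tsum_repr.
Qed.

Let tensorZE a s : tensorZ a (\pi_tensor s) = \pi_tensor (tscale a s).
Proof.
unlock tensorZ; apply/Pi_eq => P c Hc.
by rewrite !tsum_scale// tsum_repr.
Qed.

Let tensorNE s : tensorN (\pi_tensor s) = \pi_tensor (tscale (-1) s).
Proof.
unlock tensorN; apply/Pi_eq => P c Hc.
by rewrite !tsum_scale// tsum_repr.
Qed.

Let tE := (tensor0E, tensorDE, tensorZE, tensorNE).

Let tensorA : associative tensorD.
Proof.
by elim/quotW=> x; elim/quotW=> y; elim/quotW=> z; rewrite !tE catA.
Qed.

Let tensorC : commutative tensorD.
Proof.
elim/quotW=> x; elim/quotW=> y; rewrite !tE; apply/Pi_eq => P c Hc.
by rewrite !tsum_cat addrC.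
Qed.

Let tensorD0 : left_id tensor0 tensorD.
Proof. by elim/quotW=> x; rewrite !tE. Qed.

Let tensorDN : left_inverse tensor0 tensorN tensorD.
Proof.
elim/quotW=> x; rewrite !tE; apply/Pi_eq => P c Hc.
by rewrite tsum_cat tsum_scale// scaleN1r addNr /tsum big_nil.
Qed.

HB.instance Definition _ :=
  GRing.isZmodule.Build tensor tensorA tensorC tensorD0 tensorDN.

Let tensorZA a b v : tensorZ a (tensorZ b v) = tensorZ (a * b) v.
Proof.
elim/quotW: v => x; rewrite !tE; apply/Pi_eq => P c Hc.
by rewrite !tsum_scale// scalerA.
Qed.

Let tensorZ1 : left_id 1 tensorZ.
Proof.
elim/quotW=> x; rewrite !tE; apply/Pi_eq => P c Hc.
by rewrite !tsum_scale// scale1r.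
Qed.

Let tensorZDr : right_distributive tensorZ +%R.
Proof.
move=> a; elim/quotW=> x; elim/quotW=> y.
rewrite !(tE, =^~ (erefl : tensorD = +%R)).
apply/Pi_eq => P c Hc.
by rewrite !(tsum_cat, tsum_scale)// scalerDr.
Qed.

Let tensorZDl v : {morph tensorZ^~ v : a b / a + b}.
Proof.
move=> a b; elim/quotW: v => x.
rewrite !(tE, =^~ (erefl : tensorD = +%R)).
apply/Pi_eq => P c Hc.
by rewrite !(tsum_cat, tsum_scale)// scalerDl.
Qed.

HB.instance Definition _ := GRing.Zmodule_isLmodule.Build R tensor
  tensorZA tensorZ1 tensorZDr tensorZDl.

Definition pure_tensor (m : M) (n : N) : tensor := \pi_tensor [:: (m, n)].

Let tensor_lin a x y :
  a *: (\pi_tensor x : tensor) + \pi_tensor y = \pi_tensor (tscale a x ++ y).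
Proof. by rewrite -tensorDE -tensorZE. Qed.

Lemma pure_tensor_bilinear : is_bilinear pure_tensor.
Proof.
split=> [m a n n'|n a m m']; rewrite tensor_lin; apply/Pi_eq => P c Hc;
  rewrite tsum_cat tsum_scale// /tsum !big_seq1 /=.
  by rewrite Hc.1.
by have /= -> := Hc.2 n a m m'.
Qed.

Section Lift.
Variables (P : lmodType R) (c : M -> N -> P) (Hc : is_bilinear c).

Let lift (v : tensor) : P := tsum c (repr v).

Let lift_linear : linear lift.
Proof.
move=> a; elim/quotW=> x; elim/quotW=> y.
by rewrite tensor_lin /lift !tsum_repr// tsum_cat tsum_scale.
Qed.

HB.instance Definition _ := GRing.isLinear.Build R tensor P _ lift lift_linear.

Lemma tensor_lift : exists2 g : {linear tensor -> P},
  forall m n, g (pure_tensor m n) = c m n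
  & forall g' : {linear tensor -> P},
      (forall m n, g' (pure_tensor m n) = c m n) -> g' =1 g.
Proof.
exists lift => [m n|g' Hg'].
  by rewrite /= /lift tsum_repr// /tsum big_seq1.
elim/quotW=> x; rewrite /= /lift tsum_repr//.
elim: x => [|[m n] x IH].
  by rewrite -tensor0E linear0 /tsum big_nil.
rewrite -cat1s -tensorDE linearD Hg' IH.
by rewrite /tsum big_cons.
Qed.

End Lift.

End TensorProduct.

Lemma tensor_product_exists (R : comPzRingType) (M N : lmodType R) :
  exists (T : lmodType R) (t : M -> N -> T), is_tensor_product t.
Proof.
exists (tensor M N), (@pure_tensor R M N); split.
  exact: pure_tensor_bilinear.
exact: tensor_lift.
Qed.

Definition subperfect (A : comPzRingType) : Prop := perfect (total_quotient A).

(* The ideal is only required to be proper when xs is nonempty: the empty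
   sequence is regular by convention, even in the zero ring. *)
Definition regular_sequence (A : comPzRingType) (xs : seq A) : Prop :=
  (xs <> [::] -> exists a : A, a \notin gen_ideal xs) /\
  forall j, (j < size xs)%N -> nonzerodivisor (to_quo (take j xs) xs`_j).

Definition maximal_regular_sequence (A : comPzRingType) (xs : seq A) : Prop :=
  regular_sequence xs /\
  forall ys, regular_sequence (xs ++ ys) -> ys = [::].

Definition regularly_subperfect (A : comPzRingType) : Prop :=
  forall xs : seq A, regular_sequence xs -> subperfect (quo_ring xs).

(* The index is an integer so that (n - i)-subperfect needs no truncated
   subtraction. For n < 0 the last clause says that A has no maximal regular
   sequence. This does occur for k[x_1, x_2, ...], which is regularly
   subperfect, with every regular sequence extendable. *)
Definition nsubperfect (n : int) (A : comPzRingType) : Prop :=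
  regularly_subperfect A /\
  forall xs : seq A, maximal_regular_sequence xs -> (size xs)%:Z = n.

(* Main.v *)
Require Import Defs.
From HB Require Import structures.
From mathcomp Require Import all_boot all_algebra.
From mathcomp Require Import boolp.
Local Open Scope ring_scope.

(** Everything rests on the third isomorphism theorem. If [xs] is a regular
sequence of [R], then [R / (xs ++ us)] and [(R / xs) / us] are both quotients of
[R] by the same ideal, hence isomorphic ([quo_ring_cat_iso]); and [us] is regular
(resp. maximal regular) modulo [xs] exactly when [xs ++ us] is regular (resp.
maximal regular) in [R] ([regular_sequence_cat], [maximal_regular_sequence_cat]).
Since every sequence of [R / xs] lifts to [R], the regular sequences of [R / xs]
are the tails of those of [R] that start with [xs], and lengths drop by
[size xs]; this gives the direct implication. For the converse, let [xs] be
regular in [R]: the empty sequence of [R / xs] shows that [R / xs] is subperfect,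
and if [xs] is maximal, the empty sequence is maximal in [R / xs], so that
[n - size xs = 0].

Isomorphic rings are distinct types, so one must also know that subperfectness
is invariant under isomorphism ([subperfect_iso]). Total quotient rings are
functorial for the morphisms that preserve non-zero-divisors. Perfectness quantifies
over all modules, and is transported by restriction of scalars ([perfect_iso]):
along an isomorphism, restriction is an equivalence that leaves the underlying
functions unchanged, so it preserves tensor products and therefore flatness, and
it reflects projectivity. *)

Set Implicit Arguments.
Unset Strict Implicit.
Unset Printing Implicit Defensive.

Import GRing.Theory.
Local Open Scope quotient_scope.

(** * Ring isomorphisms *)

Definition ring_iso (A B : comPzRingType) : Prop :=
  exists (f : {rmorphism A -> B}) (g : {rmorphism B -> A}),
    cancel f g /\ cancel g f.

Lemma induced_rmorphism (A B C : comPzRingType)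
    (f : {rmorphism A -> B}) (g : {rmorphism A -> C}) :
    (forall b, exists a, f a = b) -> (forall a, f a = 0 -> g a = 0) ->
  exists h : {rmorphism B -> C}, forall a, h (f a) = g a.
Proof.
move=> f_surj ker_sub.
have [s sK] := choice f_surj.
have gsE a : g (s (f a)) = g a.
  by apply/eqP; rewrite -subr_eq0 -rmorphB ker_sub// rmorphB sK subrr.
have h_zmod : zmod_morphism (g \o s).
  by move=> x y /=; rewrite -{1}[x]sK -{1}[y]sK -rmorphB gsE rmorphB.
have h_mon : monoid_morphism (g \o s).
  split=> [|x y] /=; first by rewrite -(rmorph1 f) gsE rmorph1.
  by rewrite -{1}[x]sK -{1}[y]sK -rmorphM gsE rmorphM.
pose h1 := GRing.isZmodMorphism.Build B C _ h_zmod.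
pose h2 := GRing.isMonoidMorphism.Build B C _ h_mon.
by exists (HB.pack_for {rmorphism B -> C} (g \o s) h1 h2) => a; exact: gsE.
Qed.

(** The two quotients of [A] by a common kernel factor through each other, and
both composites are the identity because they are so on classes. *)
Lemma ring_iso_same_kernel (A B C : comPzRingType)
    (f : {rmorphism A -> B}) (g : {rmorphism A -> C}) :
    (forall b, exists a, f a = b) -> (forall c, exists a, g a = c) ->
    (forall a, f a = 0 <-> g a = 0) ->
  ring_iso B C.
Proof.
move=> f_surj g_surj kerE.
have [h hf] := induced_rmorphism f_surj (fun a => (kerE a).1).
have [k kg] := induced_rmorphism g_surj (fun a => (kerE a).2).
exists h, k; split=> x.
  by have [a <-] := f_surj x; rewrite hf kg.
by have [a <-] := g_surj x; rewrite kg hf.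
Qed.

(** * Perfectness is invariant under isomorphism *)

(** The carrier of [M] is kept; [f] occurs as an argument only so that the scalar
action of [A] can be inferred from the type. *)
Definition restrict_scalars (A B : comPzRingType) (f : {rmorphism A -> B})
  (M : lmodType B) : Type := M.

Section RestrictScalars.
Variables (A B : comPzRingType) (f : {rmorphism A -> B}) (M : lmodType B).
Local Notation Mf := (restrict_scalars f M).

HB.instance Definition _ := GRing.Zmodule.on Mf.

Definition restricted_scale (a : A) (m : Mf) : Mf := f a *: (m : M).

Let scaleA a b v :
  restricted_scale a (restricted_scale b v) = restricted_scale (a * b) v.
Proof. by rewrite /restricted_scale scalerA rmorphM. Qed.

Let scale1 : left_id 1 restricted_scale.
Proof. by move=> v; rewrite /restricted_scale rmorph1 scale1r. Qed.

Let scaleDr : right_distributive restricted_scale +%R.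
Proof. by move=> a u v; exact: scalerDr. Qed.

Let scaleDl v : {morph restricted_scale^~ v : a b / a + b}.
Proof. by move=> a b; rewrite /restricted_scale rmorphD; exact: scalerDl. Qed.

HB.instance Definition _ := GRing.Zmodule_isLmodule.Build A Mf
  scaleA scale1 scaleDr scaleDl.

End RestrictScalars.

Definition linear_map (R : comPzRingType) (M N : lmodType R) (h : M -> N)
    (h_lin : linear h) : {linear M -> N} :=
  HB.pack_for {linear M -> N} h (GRing.isLinear.Build R M N _ h h_lin).

Lemma restrict_linear (A B : comPzRingType) (f : {rmorphism A -> B})
    (M N : lmodType B) (h : M -> N) :
  linear h -> linear (h : restrict_scalars f M -> restrict_scalars f N).
Proof. by move=> h_lin a u v; exact: (h_lin (f a) u v). Qed.

(** For mutually inverse [f] and [g], restrictions along [f] and along [g] are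
adjoint on both sides, and the adjunctions do not change the underlying
functions. *)
Section TransportIso.
Variables (A B : comPzRingType).
Variables (f : {rmorphism A -> B}) (g : {rmorphism B -> A}).
Hypotheses (fK : cancel f g) (gK : cancel g f).

Lemma linear_restrictl (M : lmodType B) (N : lmodType A) (h : M -> N) :
  linear (h : restrict_scalars f M -> N) <->
  linear (h : M -> restrict_scalars g N).
Proof.
split=> h_lin a u v; last first.
  by have := h_lin (f a) u v; rewrite /= /GRing.scale /= /restricted_scale fK.
by have := h_lin (g a) u v; rewrite /GRing.scale /= /restricted_scale gK.
Qed.

Lemma linear_restrictr (N : lmodType A) (M : lmodType B) (h : N -> M) :
  linear (h : N -> restrict_scalars f M) <->
  linear (h : restrict_scalars g N -> M).
Proof.
split=> h_lin a u v; last first.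
  by have := h_lin (f a) u v; rewrite /GRing.scale /= /restricted_scale fK.
by have := h_lin (g a) u v; rewrite /GRing.scale /= /restricted_scale gK.
Qed.

(** The universal property of [T] is tested against a [B]-module [P] by viewing
[P] as an [A]-module; the factorization obtained there is also [B]-linear because
scalars of [B] come from [A]. *)
Lemma restrict_tensor_product (M : lmodType B) (N T : lmodType A)
    (t : M -> N -> T) :
  is_tensor_product (t : restrict_scalars f M -> N -> T) ->
  is_tensor_product
    (t : M -> restrict_scalars g N -> restrict_scalars g T).
Proof.
case=> -[t_linr t_linl] t_univ; split.
  split=> [m|n]; first exact: restrict_linear (t_linr m).
  exact/linear_restrictl/(t_linl n).
move=> P c [c_linr c_linl].
have c_bil : is_bilinear (c : restrict_scalars f M -> N -> restrict_scalars f P).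
  split=> [m|n]; last exact: restrict_linear (c_linl n).
  exact/linear_restrictr/(c_linr m).
have [h hE h_uniq] := t_univ _ _ c_bil.
have h_lin : linear (h : restrict_scalars g T -> P).
  by apply/linear_restrictr/linearP.
exists (linear_map h_lin) => [|h' h'E]; first exact: hE.
have h'_lin : linear (h' : T -> restrict_scalars f P).
  by apply/linear_restrictr/linearP.
exact: (h_uniq (linear_map h'_lin)).
Qed.

(** A test configuration for flatness over [A] becomes one over [B] by restriction
along the inverse, with the same underlying functions. *)
Lemma restrict_flat (M : lmodType B) : flat M -> flat (restrict_scalars f M).
Proof.
move=> M_flat N N' i i_inj T T' t t' tP t'P h hE.
have i_lin := @restrict_linear _ _ g _ _ _ (linearP i).
have h_lin := @restrict_linear _ _ g _ _ _ (linearP h).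
exact: (M_flat _ _ (linear_map i_lin) i_inj _ _ _ _ (restrict_tensor_product tP)
  (restrict_tensor_product t'P) (linear_map h_lin) hE).
Qed.

Lemma projective_of_restrict (M : lmodType B) :
  projective (restrict_scalars f M) -> projective M.
Proof.
move=> M_proj N P q u q_surj.
have q_lin := @restrict_linear _ _ f _ _ _ (linearP q).
have u_lin := @restrict_linear _ _ f _ _ _ (linearP u).
have [h hE] := M_proj _ _ (linear_map q_lin) (linear_map u_lin) q_surj.
have h_lin : linear (h : M -> N).
  move=> b x y; have := linearP h (g b) x y.
  by rewrite /GRing.scale /= /restricted_scale gK.
by exists (linear_map h_lin) => m; exact: hE.
Qed.

End TransportIso.

Lemma perfect_iso (A B : comPzRingType) :
  ring_iso A B -> perfect A -> perfect B.
Proof.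
case=> f [g [fK gK]] A_perfect M M_flat.
by apply: (projective_of_restrict gK); apply/A_perfect/(restrict_flat fK gK).
Qed.

(** * Total quotient rings of isomorphic rings *)

Section Fractions.
Variable A : comPzRingType.
Implicit Types a b s t : A.

Definition frac a s (s_nzd : nonzerodivisor s) : total_quotient A :=
  \pi_(total_quotient A) (mk_tfrac a s_nzd).

Lemma frac_eq a s (hs : nonzerodivisor s) b t (ht : nonzerodivisor t) :
  frac a hs = frac b ht <-> a * t = b * s.
Proof. by split=> [/eqmodP/eqP|H]//; apply/eqmodP/eqP. Qed.

Lemma fracP (x : total_quotient A) :
  exists a s (hs : nonzerodivisor s), x = frac a hs.
Proof.
elim/quotW: x => p; exists (num p), (den p), (@den_nonzerodivisor _ p).
exact/eqmodP/eqP.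
Qed.

(** The ring operations act on chosen representatives, and this relates them to
the fraction at hand. *)
Lemma frac_repr a s (hs : nonzerodivisor s) :
  let p := repr (frac a hs) in num p * s = a * den p.
Proof.
move=> p; apply/(@frac_eq _ _ (@den_nonzerodivisor _ p) _ _ hs).
by rewrite -[RHS]reprK; apply/eqmodP/eqP.
Qed.

Lemma frac1 : 1 = frac 1 (@nonzerodivisor1 A).
Proof. by []. Qed.

Lemma fracD a s (hs : nonzerodivisor s) b t (ht : nonzerodivisor t) :
  frac a hs + frac b ht = frac (a * t + b * s) (nonzerodivisorM hs ht).
Proof.
have := frac_repr b ht; have := frac_repr a hs => /=.
move=> Ha Hb; rewrite -[LHS]/(tqD _ _); unlock tqD; apply/frac_eq.
rewrite 2!mulrDl; congr (_ + _).
  by rewrite mulrACA Ha [den _ * t]mulrC mulrACA.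
by rewrite [s * t]mulrC mulrACA Hb [den _ * s]mulrC mulrACA [den _ * den _]mulrC.
Qed.

Lemma fracM a s (hs : nonzerodivisor s) b t (ht : nonzerodivisor t) :
  frac a hs * frac b ht = frac (a * b) (nonzerodivisorM hs ht).
Proof.
have := frac_repr b ht; have := frac_repr a hs => /=.
move=> Ha Hb; rewrite -[LHS]/(tqM _ _); unlock tqM; apply/frac_eq.
by rewrite mulrACA Ha Hb mulrACA.
Qed.

End Fractions.

Section FractionMap.
Variables (A B : comPzRingType) (f : {rmorphism A -> B}).
Hypothesis f_nzd : forall s, nonzerodivisor s -> nonzerodivisor (f s).

(** The formula determines a function because equality of fractions is an equation
between products in [A], which [f] preserves. *)
Lemma frac_map :
  exists h : {rmorphism total_quotient A -> total_quotient B},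
    forall a s (hs : nonzerodivisor s), h (frac a hs) = frac (f a) (f_nzd hs).
Proof.
have h_ex x : exists y, forall a s (hs : nonzerodivisor s),
    x = frac a hs -> y = frac (f a) (f_nzd hs).
  have [a [s [hs ->]]] := fracP x; exists (frac (f a) (f_nzd hs)).
  by move=> b t ht /frac_eq H; apply/frac_eq; rewrite -!rmorphM H.
have [h hP] := choice h_ex.
have hE a s (hs : nonzerodivisor s) : h (frac a hs) = frac (f a) (f_nzd hs).
  exact: hP.
have hD x y : h (x + y) = h x + h y.
  have [a [s [hs ->]]] := fracP x; have [b [t [ht ->]]] := fracP y.
  by rewrite fracD !hE fracD; apply/frac_eq; rewrite !(rmorphD, rmorphM).
have h_zmod : zmod_morphism h.
  by move=> x y; apply/eqP; rewrite eq_sym subr_eq -hD subrK.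
have h_mon : monoid_morphism h.
  split=> [|x y]; first by rewrite !frac1 hE; apply/frac_eq; rewrite rmorph1.
  have [a [s [hs ->]]] := fracP x; have [b [t [ht ->]]] := fracP y.
  by rewrite fracM !hE fracM; apply/frac_eq; rewrite !rmorphM.
pose h1 := GRing.isZmodMorphism.Build _ _ _ h_zmod.
pose h2 := GRing.isMonoidMorphism.Build _ _ _ h_mon.
by exists (HB.pack_for {rmorphism total_quotient A -> total_quotient B} h h1 h2).
Qed.

End FractionMap.

Lemma nonzerodivisor_iso (A B : comPzRingType) (f : {rmorphism A -> B})
    (g : {rmorphism B -> A}) :
  cancel f g -> cancel g f ->
  forall s, nonzerodivisor s -> nonzerodivisor (f s).
Proof.
move=> fK gK s hs b sb0; rewrite -[b]gK; apply/eqP.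
by rewrite (hs (g b)) ?rmorph0// -[s]fK -rmorphM sb0 rmorph0.
Qed.

Lemma total_quotient_iso (A B : comPzRingType) :
  ring_iso A B -> ring_iso (total_quotient A) (total_quotient B).
Proof.
case=> f [g [fK gK]].
have [h hE] := frac_map (nonzerodivisor_iso fK gK).
have [k kE] := frac_map (nonzerodivisor_iso gK fK).
exists h, k; split=> x; have [a [s [hs ->]]] := fracP x.
  by rewrite hE kE; apply/frac_eq; rewrite !fK.
by rewrite kE hE; apply/frac_eq; rewrite !gK.
Qed.

Lemma subperfect_iso (A B : comPzRingType) :
  ring_iso A B -> subperfect A -> subperfect B.
Proof. by move=> /total_quotient_iso; exact: perfect_iso. Qed.

(** * Generated ideals and their quotients *)

Section IdealMembership.
Variable A : comPzRingType.
Implicit Types (a x : A) (xs us : seq A).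

Lemma to_quo_eq0 xs a : to_quo xs a = 0 <-> a \in gen_ideal xs.
Proof. by rewrite -[a in X in _ <-> X]subr0 -to_quo_eq rmorph0. Qed.

Lemma nonzerodivisor_to_quo xs x :
  nonzerodivisor (to_quo xs x) <->
  forall a, x * a \in gen_ideal xs -> a \in gen_ideal xs.
Proof.
split=> [x_nzd a xa|x_nzd u].
  by apply/to_quo_eq0/x_nzd; rewrite -rmorphM; apply/to_quo_eq0.
have [a <-] := to_quo_surj u.
by rewrite -rmorphM => /to_quo_eq0/x_nzd/to_quo_eq0.
Qed.

Lemma gen_ideal_nil a : a \in gen_ideal [::] <-> a = 0.
Proof.
split=> [/gen_idealP[c ->]|->]; first by rewrite big_ord0.
exact: rpred0.
Qed.

Lemma gen_ideal_cons x us a :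
  a \in gen_ideal (x :: us) <-> exists b, a - b * x \in gen_ideal us.
Proof.
split=> [/gen_idealP[c ->]|[b /gen_idealP[c aE]]].
  exists (c 0%N); rewrite big_ord_recl addrC addKr; apply/gen_idealP.
  by exists (fun i => c i.+1).
apply/gen_idealP; exists (fun i => if i is j.+1 then c j else b).
by rewrite big_ord_recl/= -aE addrC subrK.
Qed.

End IdealMembership.

Section QuotientByRegularSequence.
Variable A : comPzRingType.
Implicit Types (a x : A) (xs us : seq A).

Lemma gen_ideal_catE xs us a :
  a \in gen_ideal (xs ++ us) <->
  exists2 b, b \in gen_ideal us & a - b \in gen_ideal xs.
Proof.
elim: xs a => [|x xs IH] a /=.
  split=> [a_us|[b b_us /gen_ideal_nil/subr0_eq->]]//.
  by exists a => //; rewrite subrr rpred0.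
rewrite gen_ideal_cons; split=> [[c /IH[b b_us acb]]|[b b_us]].
  by exists b => //; apply/gen_ideal_cons; exists c; rewrite addrAC.
case/gen_ideal_cons=> c acb; exists c; apply/IH.
by exists b => //; rewrite addrAC.
Qed.

Lemma gen_ideal_map (B : comPzRingType) (f : {rmorphism A -> B}) us (b : B) :
  (forall b, exists a, f a = b) ->
  b \in gen_ideal (map f us) <-> exists2 a, a \in gen_ideal us & f a = b.
Proof.
move=> f_surj; elim: us b => [|u us IH] b /=.
  rewrite gen_ideal_nil; split=> [->|[a /gen_ideal_nil-> <-]]; last exact: rmorph0.
  by exists 0; rewrite ?rpred0 ?rmorph0.
rewrite gen_ideal_cons; split=> [[v /IH[a a_us fa]]|[a /gen_ideal_cons[c ac] <-]].
  have [c vE] := f_surj v; exists (a + c * u).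
    by apply/gen_ideal_cons; exists c; rewrite addrK.
  by rewrite rmorphD rmorphM fa vE subrK.
by exists (f c); apply/IH; exists (a - c * u); rewrite // rmorphB rmorphM.
Qed.

(** The preimage in [A] of the ideal generated by [us] modulo [xs] is the ideal
generated by [xs ++ us]; every comparison between [A / (xs ++ us)] and
[(A / xs) / us] reduces to this. *)
Lemma gen_ideal_cat xs us a :
  a \in gen_ideal (xs ++ us) <-> to_quo xs a \in gen_ideal (map (to_quo xs) us).
Proof.
rewrite gen_ideal_catE (gen_ideal_map _ _ (@to_quo_surj _ xs)).
by split=> -[b b_us ab]; exists b => //; [apply/esym|]; apply/to_quo_eq.
Qed.

Lemma map_to_quo_surj xs (us : seq (quo_ring xs)) :
  exists ys, map (to_quo xs) ys = us.
Proof.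
have [lift liftK] := choice (@to_quo_surj A xs).
by exists (map lift us); rewrite (mapK liftK).
Qed.

(** The third isomorphism theorem. *)
Lemma quo_ring_cat_iso xs us :
  ring_iso (quo_ring (xs ++ us)) (quo_ring (map (to_quo xs) us)).
Proof.
apply: (@ring_iso_same_kernel A _ _ (to_quo (xs ++ us))
  (to_quo (map (to_quo xs) us) \o to_quo xs)) => [u|v|a].
- exact: to_quo_surj.
- have [u <-] := to_quo_surj v; have [a <-] := to_quo_surj u.
  by exists a.
- by rewrite /= !to_quo_eq0 gen_ideal_cat.
Qed.

(** Lets the instance of regular subperfectness at the empty sequence be read as
subperfectness of the ring itself. *)
Lemma quo_ring_nil_iso : ring_iso (quo_ring ([::] : seq A)) A.
Proof.
apply: (@ring_iso_same_kernel A _ _ (to_quo [::]) idfun) => [u|a|a].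
- exact: to_quo_surj.
- by exists a.
- by rewrite to_quo_eq0 gen_ideal_nil.
Qed.

(** * Regular sequences modulo a regular sequence *)

Lemma proper_cat xs us :
  (exists a, a \notin gen_ideal (xs ++ us)) <->
  (exists u, u \notin gen_ideal (map (to_quo xs) us)).
Proof.
split=> [[a a_nin]|[u]].
  by exists (to_quo xs a); apply: contra a_nin => /gen_ideal_cat.
have [a <-] := to_quo_surj u => a_nin.
by exists a; apply: contra a_nin => /gen_ideal_cat.
Qed.

Lemma nonzerodivisor_cat xs us x :
  nonzerodivisor (to_quo (xs ++ us) x) <->
  nonzerodivisor (to_quo (map (to_quo xs) us) (to_quo xs x)).
Proof.
rewrite !nonzerodivisor_to_quo; split=> x_nzd => [u|a].
  by have [a <-] := to_quo_surj u; rewrite -rmorphM -!gen_ideal_cat => /x_nzd.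
by rewrite !gen_ideal_cat rmorphM => /x_nzd.
Qed.

(** The conditions on the entries of [us] agree on both sides, and those on the
entries of [xs] hold by assumption. Properness of [xs] is what makes the case
[us = [::]] of the converse work: the empty sequence is regular modulo [xs] by
convention, whereas [xs ++ [::]] has to generate a proper ideal. *)
Lemma regular_sequence_cat xs us :
  regular_sequence xs ->
  (regular_sequence (xs ++ us) <-> regular_sequence (map (to_quo xs) us)).
Proof.
case=> xs_proper xs_reg.
have nzd_us j : (j < size us)%N ->
    nonzerodivisor (to_quo (take (size xs + j) (xs ++ us))
      (nth 0 (xs ++ us) (size xs + j))) <->
    nonzerodivisor (to_quo (take j (map (to_quo xs) us))
      (nth 0 (map (to_quo xs) us) j)).
  move=> j_us; rewrite takeD take_size_cat// drop_size_cat// nonzerodivisor_cat.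
  by rewrite nth_cat ltnNge leq_addr/= addKn -map_take (nth_map 0).
split=> -[us_proper us_reg]; split.
- move=> us_neq0; apply/proper_cat/us_proper.
  case: us us_neq0 {us_proper us_reg nzd_us} => // u us _.
  by case: xs {xs_proper xs_reg}.
- rewrite size_map => j j_us; apply/(nzd_us j j_us)/us_reg.
  by rewrite size_cat ltn_add2l.
- move=> xsus_neq0; have [us0|us_neq0] := eqVneq us [::].
    by move: xsus_neq0; rewrite us0 cats0.
  apply/proper_cat/us_proper.
  by case: us us_neq0 {us_proper us_reg nzd_us xsus_neq0}.
- move=> j; rewrite size_cat; have [j_xs _|xs_j j_lt] := ltnP j (size xs).
    by rewrite takel_cat ?(ltnW j_xs)// nth_cat j_xs; apply: xs_reg.
  have j_us : (j - size xs < size us)%N by rewrite ltn_subLR.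
  rewrite -[j](subnKC xs_j); apply/(nzd_us _ j_us)/us_reg.
  by rewrite size_map.
Qed.

(** Extensions of [us] modulo [xs] lift to extensions of [xs ++ us]. *)
Lemma maximal_regular_sequence_cat xs us :
  regular_sequence xs ->
  (maximal_regular_sequence (xs ++ us) <->
   maximal_regular_sequence (map (to_quo xs) us)).
Proof.
move=> xs_reg; split=> -[us_reg us_max].
  split=> [|vs]; first exact/(regular_sequence_cat us xs_reg).
  have [ys <-] := map_to_quo_surj vs.
  rewrite -map_cat => /(regular_sequence_cat _ xs_reg).
  by rewrite catA => /us_max ->.
split=> [|ys]; first exact/(regular_sequence_cat us xs_reg).
rewrite -catA => /(regular_sequence_cat _ xs_reg); rewrite map_cat => /us_max.
by case: ys.
Qed.

End QuotientByRegularSequence.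

Theorem proposition3p2 (n : nat) (R : comPzRingType) :
  nsubperfect n%:Z R <->
  forall xs : seq R, regular_sequence xs ->
    nsubperfect (n%:Z - (size xs)%:Z) (quo_ring xs).
Proof.
split=> [[R_sub R_len] xs xs_reg|quo_sub].
  split=> us; have [ys <-] := map_to_quo_surj us.
    move=> /(regular_sequence_cat _ xs_reg)/R_sub.
    exact/subperfect_iso/quo_ring_cat_iso.
  move=> /(maximal_regular_sequence_cat _ xs_reg)/R_len <-.
  by rewrite size_map size_cat PoszD addrC addKr.
split=> [xs xs_reg|xs xs_max].
  have [xs_sub _] := quo_sub xs xs_reg.
  apply: (subperfect_iso (quo_ring_nil_iso _)); apply: xs_sub.
  by apply/(regular_sequence_cat [::] xs_reg); rewrite cats0.
have [xs_reg _] := xs_max.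
have [_ xs_len] := quo_sub xs xs_reg.
(* As [xs] cannot be extended, the empty sequence is maximal modulo [xs]. *)
have := xs_len [::]; rewrite /= => len0.
apply/esym/eqP; rewrite -subr_eq0; apply/eqP/esym/len0.
by apply/(maximal_regular_sequence_cat [::] xs_reg); rewrite cats0.
Qed.
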